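(* Let $\theta=\cos^{-1}\!\left(\frac{1}{2\sqrt{2}}\right)$. For every integer $n\ge 1$, \begin{align*} S_2(n;1)&=\frac{1}{4n}\sum_{j\mid n}[\![2\nmid j]\!]\,\mu(j) \left(2^{n/j}+1-(-1)^{n/j}2^{(n/2j)+1}\cos(n\theta/j)\right),\\ S_2(n;0)&=\frac{1}{4n}\sum_{j\mid n}[\![2\nmid j]\!]\,\mu(j) \left(2^{n/j}-1+(-1)^{n/j}2^{(n/2j)+1}\cos(n\theta/j)\right), \end{align*} where the sums are over positive divisors $j$ of $n$.
   Context: A monic polynomial $f\in\mathbb{F}_2[x]$ is self-reciprocal if $x^{\deg f}f(1/x)=f(x)$. For $a\in\mathbb{F}_2$, $S_2(n;a)$ denotes the number of self-reciprocal monic irreducible polynomials $f\in\mathbb{F}_2[x]$ of degree $2n$ with $[x^{2n-1}]f=a$. $\mu$ is the Möbius function, and $[\![P]\!]$ is $1$ if $P$ is true and $0$ otherwise. *)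

(* Defs.v *)
From HB Require Import structures.
From mathcomp Require Import all_boot all_order all_algebra.
From mathcomp Require Import all_classical all_reals all_analysis.
Set Implicit Arguments. Unset Strict Implicit. Unset Printing Implicit Defensive.
Import Order.TTheory GRing.Theory Num.Theory.
Local Open Scope ring_scope.

Definition moebius (n : nat) : int :=
  if n == 0%N then 0
  else if all (fun p => logn p n == 1%N) (primes n) then (-1) ^+ size (primes n)
  else 0.

(* x^{deg f} f(1/x), written coefficientwise. *)
Definition reciprocal (F : nzRingType) (f : {poly F}) : {poly F} :=
  \poly_(i < size f) f`_((size f).-1 - i).

Definition self_reciprocal (F : nzRingType) (f : {poly F}) : Prop :=
  reciprocal f = f.

Definition monic_of (m : nat) (t : m.-tuple 'F_2) : {poly 'F_2} :=
  'X^m + \poly_(i < m) nth 0 t i.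

(* S_2(n;a): number of self-reciprocal monic irreducible f in F_2[x] of degree 2n
   with [x^{2n-1}] f = a.  Monic polynomials of degree 2n are enumerated
   bijectively by their lower 2n coefficients. *)
Definition S2 (n : nat) (a : 'F_2) : nat :=
  #|[set t : (2 * n).-tuple 'F_2 |
      `[< irreducible_poly (monic_of t) /\ self_reciprocal (monic_of t)
          /\ (monic_of t)`_(2 * n).-1 = a >] ]|.

(* Main.v *)
(* Only the multiplicative structure of F_2[x] is used, not the fields F_(2^n).
   Fix s = 1 or s = -1 and set slope(f) = s^(f_1), which is multiplicative on
   polynomials with f(0) = 1; write f' for the reciprocal of f.
   Two L-functions are compared:
   - L(T), the sum of slope(f f') T^(deg f) over f(0) = 1; for s = -1 it equals
     1 + T + 2T^2 (Kloosterman sums), since f_1 and f_(deg f - 1) can be flipped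
     independently in degree >= 3, and for s = 1 it equals (1-T)/(1-2T);
   - Z(T), the sum of slope(f) T^(deg f / 2) over self-reciprocal f with
     f(0) = f(1) = 1; it equals 1 - T for s = -1 and (1-T)/(1-2T) for s = 1.
   The Euler factors of Z come from the self-reciprocal irreducibles P and from
   the products P P', and so Z^2 (1-T)^-1 / L is the product of
   (1 + slope(P) T^d) / (1 - slope(P) T^d) over self-reciprocal irreducibles P of
   degree 2d. Logarithmic derivatives turn this into a formula for
   the sum of 2d (S_2(d;0) + s S_2(d;1)) over d | m with m/d odd, and Moebius
   inversion over odd divisors finishes the proof. The reciprocal roots of
   1 + T + 2T^2 are -sqrt 2 e^(+- i theta). *)
Require Import Defs.
From HB Require Import structures.
From mathcomp Require Import all_boot all_order all_algebra.
From mathcomp Require Import all_classical all_reals all_analysis.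
From mathcomp Require Import zify ring lra.
Import Order.TTheory GRing.Theory Num.Theory.
Local Open Scope ring_scope.
Set Implicit Arguments. Unset Strict Implicit. Unset Printing Implicit Defensive.

(* [lia] does not identify two copies of [size p] that differ by the inferred
   structures, hence the generalization. *)
Ltac slia := repeat match goal with
    H : is_true (leq _ _) |- _ => move: H | H : @eq nat _ _ |- _ => move: H end;
  repeat match goal with |- context [size ?s] => move: (size s) => ? end; lia.

(** * Reversal of polynomials over an integral domain *)

Section Reciprocal.
Context {F : idomainType}.
Implicit Types f g : {poly F}.

Lemma coef_reciprocal f i :
  (reciprocal f)`_i = if (i < size f)%N then f`_((size f).-1 - i) else 0.
Proof. by rewrite coef_poly. Qed.

Lemma size_reciprocal f : f`_0 != 0 -> size (reciprocal f) = size f.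
Proof.
move=> f0; rewrite size_poly_eq // subnn //.
Qed.

Lemma reciprocal0 f : (reciprocal f)`_0 = lead_coef f.
Proof.
rewrite coef_reciprocal subn0 lead_coefE; case: ltnP => //.
by rewrite leqn0 => /eqP s0; rewrite s0 nth_default ?s0.
Qed.

Lemma reciprocalK f : f`_0 != 0 -> reciprocal (reciprocal f) = f.
Proof.
move=> f0; apply/polyP => i; rewrite !coef_reciprocal size_reciprocal //.
case: ltnP => [lti|lei]; last by rewrite nth_default.
rewrite ifT; last by lia.
by congr (_`_ _); lia.
Qed.

(** Reversal with respect to the fixed length [size (f * g)] is linear, so [f] can be expanded into
    monomials; a factor X^i then becomes X^(deg f - i) in front of [reciprocal g]. *)
Lemma reciprocalM f g : reciprocal (f * g) = reciprocal f * reciprocal g.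
Proof.
have [->|fn0] := eqVneq f 0.
  by rewrite mul0r /reciprocal size_poly0 !poly_def big_ord0 mul0r.
have [->|gn0] := eqVneq g 0.
  by rewrite mulr0 /reciprocal size_poly0 !poly_def big_ord0 mulr0.
have sf : (0 < size f)%N by rewrite size_poly_gt0.
have sg : (0 < size g)%N by rewrite size_poly_gt0.
have sfg := size_mul fn0 gn0.
pose m := size (f * g).
pose rv (p : {poly F}) := \poly_(i < m) p`_(m.-1 - i).
have rvX (i : nat) : (i < size f)%N ->
  rv ('X^i * g) = 'X^((size f).-1 - i) * reciprocal g.
  move=> lti; apply/polyP => j.
  rewrite !coefXnM coef_poly coefXnM coef_reciprocal /m sfg.
  case: (ltnP j ((size f).-1 - i)) => [c1|c1].
    case: ifP => // _; case: ifP => // _; rewrite nth_default //.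
    by slia.
  case: (ltnP j (size f + size g).-1) => [c2|c2]; last first.
    by rewrite ifF //; slia.
  case: (ltnP _ i) => [c3|c3].
    by rewrite ifF //; slia.
  by rewrite ifT; [congr (_`_ _)|]; slia.
have -> : reciprocal (f * g) = rv (\sum_(i < size f) f`_i *: ('X^i * g)).
  suff <- : f * g = \sum_(i < size f) f`_i *: ('X^i * g) by [].
  rewrite -{1}[f]coefK poly_def mulr_suml.
  by apply: eq_bigr => i _; rewrite scalerAl.
have -> : rv (\sum_(i < size f) f`_i *: ('X^i * g)) =
    \sum_(i < size f) f`_i *: rv ('X^i * g).
  apply/polyP => j; rewrite coef_poly !coef_sum; case: ifP => jm.
    by apply: eq_bigr => i _; rewrite !coefZ coef_poly jm.
  by rewrite big1 // => i _; rewrite coefZ coef_poly jm mulr0.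
under eq_bigr => i _ do rewrite (rvX _ (ltn_ord i)) scalerAl.
rewrite -mulr_suml; congr (_ * _); rewrite /reciprocal poly_def.
rewrite [RHS](reindex_inj rev_ord_inj) /=; apply: eq_bigr => i _.
by case: i => i lti /=; congr (_`_ _ *: 'X^_); slia.
Qed.

End Reciprocal.

(** * Factorisation into irreducibles over F_2 *)

Section F2Poly.
Implicit Types (f g : {poly 'F_2}) (a : 'F_2).

Lemma F2P a : a = 0 \/ a = 1.
Proof. by case: a => [[|[|//]] i]; [left|right]; apply: val_inj. Qed.

Lemma F2_neq0 a : (a != 0) = (a == 1).
Proof. by case: (F2P a) => ->. Qed.

Lemma eqp_F2 f g : f %= g -> f = g.
Proof.
case/eqpP => [[c d]] /= /andP[]; rewrite !F2_neq0 => /eqP-> /eqP->.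
by rewrite !scale1r.
Qed.

Lemma irreducible_divisor f :
  (1 < size f)%N -> exists2 Q, irreducible_poly Q & Q %| f.
Proof.
move: {2}(size f) (leqnn (size f)) => n.
elim: n f => [|n IHn] f sfn sf; first by rewrite ltnNge (leq_trans sfn) in sf.
have [/irreducibleP irrf|] := boolP (irreducibleb f); first by exists f.
rewrite /irreducibleb sf /= => /forallPn[q].
rewrite negb_imply -ltnNge -Pdiv.Idomain.dvdpE => /andP[dqf sq].
have [|Q irrQ dQ] := IHn q _ sq.
  by have := size_npoly q; move: sfn sf sq; slia.
by exists Q => //; apply: dvdp_trans dQ dqf.
Qed.

Lemma irreducible_coprimep f g :
  irreducible_poly f -> irreducible_poly g -> f != g -> coprimep f g.
Proof.
move=> irrf irrg; apply: contraR => ncop.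
have: ~~ (size (gcdp f g) == 1%N) by [].
move=> sn1; have ef := irrf.2 _ sn1 (dvdp_gcdl _ _).
have eg := irrg.2 _ sn1 (dvdp_gcdr _ _).
by apply/eqP/eqp_F2; rewrite -(eqp_ltrans ef).
Qed.

Lemma size_exp_F2 f k : f != 0 -> size (f ^+ k) = ((size f).-1 * k).+1.
Proof.
move=> f0; have := size_exp f k; have : (0 < size (f ^+ k))%N.
  by rewrite size_poly_gt0 expf_neq0.
by case: (size (f ^+ k)) => // n _ /= ->.
Qed.

(** The sum of truth values is the multiplicity of [P], the size bound making the cut at [M]
    harmless. [Q] is coprime to every other irreducible; for [P] = [Q] the exponents shift by
    one. *)
Lemma sum_dvdp_expM M (P Q g : {poly 'F_2}) :
  irreducible_poly P -> irreducible_poly Q -> Q * g != 0 ->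
  (size (Q * g)%R <= M)%N ->
  (\sum_(1 <= k < M) (P ^+ k %| Q * g)%R =
   \sum_(1 <= k < M) (P ^+ k %| g)%R + (P == Q))%N.
Proof.
move=> irrP irrQ Qg0 sM; have [eqPQ|neqPQ] := eqVneq P Q; last first.
  rewrite addn0; apply: eq_bigr => k _.
  by rewrite Gauss_dvdpr // coprimep_expl // irreducible_coprimep.
have Q0 := irredp_neq0 irrQ.
have g0 : g != 0 by apply: contraNneq Qg0 => ->; rewrite mulr0.
have := size_mul Q0 g0; have := irrQ.1; have : (0 < size g)%N by rewrite size_poly_gt0.
move=> sg sQ sQg.
have M1 : (1 < M)%N by move: sg sQ sQg sM; slia.
case: M sM M1 => [//|M] sM M0; rewrite eqPQ big_add1 /=.
under eq_bigr => k _ do rewrite exprS dvdp_mul2l //.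
(* The top exponent is too large for [g] by degree, so the shift loses nothing. *)
rewrite big_nat_recr //= (_ : (Q ^+ M %| g) = false).
  by rewrite !addn0 big_ltn // expr0 dvd1p addnC.
apply: contraTF sM => /dvdp_leq-/(_ g0); rewrite size_exp_F2 // -ltnNge.
have : (M <= (size Q).-1 * M)%N by rewrite leq_pmull //; move: sQ; slia.
by move: sg sQ sQg; slia.
Qed.

(** Degree count of the factorisation: the inner sum is the multiplicity of [P]. Induction splits
    off one irreducible factor, which adds its degree on both sides. *)
Lemma sum_size_irreducible M f : f != 0 -> (size f <= M)%N ->
  (\sum_(P : {poly_M 'F_2} | irreducibleb P)
     (size P).-1 * \sum_(1 <= k < M) ((P : {poly _}) ^+ k %| f)%R = (size f).-1)%N.
Proof.
move: {2}(size f) (leqnn (size f)) => n.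
elim: n f => [|n IHn] f sfn f0 sf.
  by rewrite leqn0 size_poly_eq0 (negPf f0) in sfn.
have [sf1|sf1] := leqP (size f) 1.
  have -> : (size f).-1 = 0%N by move: sf1; slia.
  apply: big1 => P /irreducibleP irrP.
  rewrite big_nat big1 ?muln0 // => k /andP[k0 _].
  case: dvdpP => //= dP; have := dvdp_leq f0 (introT (dvdpP _ _) dP).
  rewrite size_exp_F2 ?irredp_neq0 // => /leq_trans/(_ sf1).
  by rewrite ltnS leqn0 muln_eq0 => /orP[/eqP|/eqP]; have := irrP.1; slia.
have [Q irrQ /dvdpP[g def_f]] := irreducible_divisor sf1.
rewrite mulrC in def_f; have Q0 := irredp_neq0 irrQ.
have g0 : g != 0 by apply: contraNneq f0 => g0; rewrite def_f g0 mulr0.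
have := size_mul Q0 g0; rewrite -def_f => sizef.
have sg : (0 < size g)%N by rewrite size_poly_gt0.
have sQ := irrQ.1.
have sQM : (size Q <= M)%N by move: sf sizef sg; slia.
under eq_bigr => P /irreducibleP irrP.
  rewrite def_f sum_dvdp_expM -?def_f // mulnDr.
  over.
rewrite big_split /= IHn //; [|by move: sfn sizef sQ sg; slia..].
rewrite (bigD1 (npolyp M Q)) /=; last by rewrite npolypK //; apply/irreducibleP.
rewrite npolypK // eqxx big1 => [|P /andP[_ neqPQ]].
  by move: sizef sQ sg; slia.
case: eqP => //= eqPQ; last by rewrite muln0.
by rewrite -val_eqE /= npolypK // eqPQ eqxx in neqPQ.
Qed.

End F2Poly.

(** * Changes of variable in sums over polynomials of bounded degree *)

Section NpolySum.
Context {F : finNzRingType} {R : nmodType} (M : nat).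

(** [h] and [h'] act on bare polynomials and need only be mutually inverse between the two subsets,
    where [npolyp M] truncates nothing. *)
Lemma big_npoly_bij (P Q : pred {poly F}) (G : {poly F} -> R)
    (h h' : {poly F} -> {poly F}) :
  (forall f : {poly F}, (size f <= M)%N -> P f ->
     [/\ Q (h' f), (size (h' f) <= M)%N & h (h' f) = f]) ->
  (forall f : {poly F}, (size f <= M)%N -> Q f ->
     [/\ P (h f), (size (h f) <= M)%N & h' (h f) = f]) ->
  \sum_(f : {poly_M F} | P f) G f = \sum_(f : {poly_M F} | Q f) G (h f).
Proof.
move=> hP hQ.
rewrite (reindex_onto (fun f : {poly_M F} => npolyp M (h f))
                      (fun f : {poly_M F} => npolyp M (h' f))) /=.
  apply: eq_big => [f|f].
    apply/idP/idP => [/andP[Pf /eqP def_f]|Qf].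
      have [Qg sg _] := hP _ (size_npoly _) Pf.
      by rewrite -def_f npolypK.
    have [Ph sh hK] := hQ _ (size_npoly f) Qf.
    by rewrite -val_eqE /= !npolypK ?Ph ?hK ?eqxx.
  case/andP=> Pf /eqP def_f.
  have [Qg sg _] := hP _ (size_npoly _) Pf.
  have fE := congr1 val def_f; rewrite /= (npolypK sg) in fE.
  rewrite fE in Qg; have [_ sh _] := hQ _ (size_npoly f) Qg.
  by rewrite npolypK.
move=> f Pf; have [Qg sg hK] := hP _ (size_npoly f) Pf.
by apply: val_inj; rewrite /= [npolyp M (h' f) : {poly F}]npolypK // hK npolypK.
Qed.

End NpolySum.

(** * Generating functions over F_2[x] and their logarithmic derivatives *)

Section LogDerivative.
Context {R : comNzRingType} (M : nat).
Implicit Types (C D : pred {poly 'F_2}) (e : {poly 'F_2} -> {poly 'F_2}).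
Implicit Types w : {poly 'F_2} -> R.

(** The coefficient of T^n in the generating function of [w] over [C]; it is complete only for
    [n < M]. *)
Definition degree_sum C w n : R :=
  \sum_(f : {poly_M 'F_2} | C f && (size f == n.+1)) w f.

(** The coefficient of T^m in T L'/L, where [e P] is the element of [C] that a factor [P] forces.
    The multiplier is the degree of [P], not of [e P]: when [e P] = P P', both P and P' contribute,
    and their degrees add up to that of [e P]. *)
Definition irreducible_sum D e w m : R :=
  \sum_(P : {poly_M 'F_2} | irreducibleb P && D P)
    (\sum_(1 <= k < M | (k * (size (e P)).-1 == m)%N) w (e P) ^+ k) *+ (size P).-1.

(** Division by [g] is a bijection from these multiples onto the elements of [C] of degree n - deg
    g, under which the weight loses the factor [w g]. *)
Lemma degree_sum_multiples C w (g : {poly 'F_2}) n :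
  (n < M)%N -> g != 0 -> (forall h, C (g * h) = C h) ->
  (forall h, C h -> w (g * h) = w g * w h) ->
  \sum_(f : {poly_M 'F_2} | [&& C f, size f == n.+1 & g %| f]) w f =
  if ((size g).-1 <= n)%N then w g * degree_sum C w (n - (size g).-1) else 0.
Proof.
move=> nM g0 Cg wg; have sg : (0 < size g)%N by rewrite size_poly_gt0.
case: leqP => [dn|nd]; last first.
  apply: big1 => f /and3P[_ /eqP sf /dvdp_leq].
  have -> : val f != 0 by rewrite -size_poly_gt0 sf.
  by move=> /(_ isT); rewrite sf; slia.
rewrite mulr_sumr.
rewrite (@big_npoly_bij _ _ _ (fun f => [&& C f, size f == n.+1 & g %| f])
   (fun h => C h && (size h == (n - (size g).-1).+1)) w ( *%R g) (fun f => f %/ g)).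
- by apply: eq_bigr => h /andP[Ch _]; rewrite wg.
- move=> f sfM /and3P[Cf /eqP sf dgf]; have := divpK dgf; rewrite mulrC => gK.
  have h0 : f %/ g != 0.
    by apply: contra_eq_neq gK => ->; rewrite mulr0 eq_sym -size_poly_gt0 sf.
  have := size_mul g0 h0; rewrite gK sf => sfE.
  have sh : (0 < size (f %/ g)%R)%N by rewrite size_poly_gt0.
  split=> //; first by rewrite -Cg gK Cf; apply/eqP; move: sg; slia.
  by move: nM sg; slia.
- move=> h shM /andP[Ch /eqP sh].
  have h0 : h != 0 by rewrite -size_poly_gt0 sh.
  have sgh : size (g * h) = n.+1 by rewrite size_mul // sh; move: dn sg; slia.
  by rewrite Cg Ch sgh eqxx dvdp_mulr // [g * h]mulrC mulpK.
Qed.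

(* Counting the prime powers dividing each [f] with weight [deg P] yields
   [deg f]; summing over [f] gives the coefficient form of [T L' = L (T L'/L)]
   for the generating function [L] of the degree sums. *)
Theorem degree_sum_log_derivative C D e w n :
  (forall f, C f -> f != 0) ->
  (forall P : {poly 'F_2}, irreducible_poly P -> D P -> (1 < size (e P))%N) ->
  (forall (P f : {poly 'F_2}) k, irreducible_poly P -> C f -> (0 < k)%N ->
     (P ^+ k %| f) = D P && (e P ^+ k %| f)) ->
  (forall P h : {poly 'F_2}, irreducible_poly P -> D P -> C (e P * h) = C h) ->
  (forall P h : {poly 'F_2}, irreducible_poly P -> D P -> C h ->
     w (e P * h) = w (e P) * w h) -> C 1 -> w 1 = 1 ->
  (n < M)%N ->
  degree_sum C w n *+ n =
  \sum_(1 <= m < n.+1) degree_sum C w (n - m) * irreducible_sum D e w m.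
Proof.
move=> C0 se De Ce we C1 w1 nM.
have CX P h k : irreducible_poly P -> D P -> C (e P ^+ k * h) = C h.
  by move=> iP DP; elim: k => [|k IHk]; rewrite ?mul1r // exprS -mulrA Ce.
have wX P k : irreducible_poly P -> D P -> w (e P ^+ k) = w (e P) ^+ k.
  move=> iP DP; elim: k => [//|k IHk]; rewrite !exprS we ?IHk //.
  by rewrite -[e P ^+ k]mulr1 CX.
have wXM P h k : irreducible_poly P -> D P -> C h ->
    w (e P ^+ k * h) = w (e P ^+ k) * w h.
  move=> iP DP Ch; elim: k => [|k IHk]; first by rewrite w1 !mul1r.
  by rewrite wX // exprS -mulrA we ?CX // IHk wX // exprS mulrA.
(* The degree of [f] is replaced by the weighted count of prime powers, and the sum over [f] moves
   inside. *)
transitivity (\sum_(P : {poly_M 'F_2} | irreducibleb P) (\sum_(1 <= k < M)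
    \sum_(f : {poly_M 'F_2} | [&& C f, size f == n.+1 & (P : {poly _}) ^+ k %| f])
      w f) *+ (size P).-1).
  rewrite -sumrMnl.
  transitivity (\sum_(f : {poly_M 'F_2} | C f && (size f == n.+1))
    \sum_(P : {poly_M 'F_2} | irreducibleb P)
      (\sum_(1 <= k < M) w f *+ ((P : {poly _}) ^+ k %| f)%R) *+ (size P).-1).
    apply: eq_bigr => f /andP[Cf /eqP sf].
    have -> : n = (size f).-1 by rewrite sf.
    rewrite -(sum_size_irreducible (C0 _ Cf) (size_npoly f)) -sumrMnr.
    by apply: eq_bigr => P _; rewrite mulnC mulrnA -sumrMnr.
  rewrite exchange_big; apply: eq_bigr => P _; rewrite sumrMnl; congr (_ *+ _).
  rewrite exchange_big; apply: eq_bigr => k _.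
  under [RHS]eq_bigl => f do rewrite andbA.
  by rewrite [RHS]big_mkcondr; apply: eq_bigr => f _; rewrite mulrb.
(* Divisibility by P^k is divisibility by [e P ^+ k], of degree m = k deg(e P), so the cofactors
   give the degree sum at [n - m]. Writing [m] as an index prepares the exchange of sums; for m > n
   the inner sum is empty. *)
transitivity (\sum_(P : {poly_M 'F_2} | irreducibleb P && D P) (\sum_(1 <= k < M)
    \sum_(1 <= m < n.+1 | (k * (size (e P)).-1 == m)%N)
     degree_sum C w (n - m) * w (e P) ^+ k) *+ (size P).-1).
  rewrite [RHS]big_mkcondr; apply: eq_bigr => P /irreducibleP iP.
  case: ifP => DP; last first.
    rewrite big_nat big1 ?mul0rn // => k /andP[k0 _]; apply: big_pred0 => f.
    by apply/and3P => -[Cf _]; rewrite De // DP.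
  congr (_ *+ _); apply: eq_big_nat => k /andP[k0 _].
  have e0 : e P != 0 by rewrite -size_poly_gt0 (leq_trans _ (se _ iP DP)).
  rewrite (eq_bigl (fun f : {poly_M 'F_2} =>
      [&& C f, size f == n.+1 & e P ^+ k %| f])); last first.
    by move=> f; case Cf: (C f) => //=; rewrite De // DP.
  rewrite degree_sum_multiples ?expf_neq0 //; first last.
  - by move=> h; apply: wXM.
  - by move=> h; apply: CX.
  rewrite size_exp_F2 //= [((size _).-1 * k)%N]mulnC; case: leqP => [le|lt]; last first.
    rewrite big_nat_cond big_pred0 // => m.
    apply/negP => /andP[/andP[_ mn] /eqP E].
    by have := leq_trans lt (eq_leq E); rewrite ltnNge -ltnS mn.
  rewrite (big_rem (k * (size (e P)).-1)) /=; last first.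
    rewrite mem_index_iota ltnS le andbT muln_gt0 k0 /=.
    by move: (se _ iP DP); slia.
  rewrite eqxx wX // mulrC [X in _ + X]big1_seq ?addr0 // => m /andP[/eqP <-].
  by rewrite mem_rem_uniqF // iota_uniq.
rewrite /irreducible_sum.
under [RHS]eq_bigr => m _.
  rewrite mulr_sumr; under eq_bigr => P _ do rewrite mulrnAr mulr_sumr.
  over.
rewrite [RHS]exchange_big; apply: eq_bigr => P _ /=.
rewrite sumrMnl; congr (_ *+ _).
by rewrite (exchange_big_dep xpredT).
Qed.

End LogDerivative.

(** * Self-reciprocal polynomials *)

Section SelfReciprocal.
Implicit Types (f g h P : {poly 'F_2}).

Lemma addF2 (a : 'F_2) : a + a = 0.
Proof. by case: (F2P a) => ->; apply: val_inj. Qed.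

Lemma self_reciprocalP f m : size f = m.+1 ->
  reflect (forall i, (i <= m)%N -> f`_i = f`_(m - i)) (reciprocal f == f).
Proof.
move=> sf; apply: (iffP eqP) => [rf i im|pal].
  by rewrite -[in LHS]rf coef_reciprocal sf ltnS im.
apply/polyP => i; rewrite coef_reciprocal sf ltnS.
case: leqP => [im|mi]; first by rewrite -pal.
by rewrite nth_default // sf.
Qed.

Lemma self_reciprocalD f g m : size f = m.+1 -> (size g <= m)%N ->
  (forall i, (i <= m)%N -> g`_i = g`_(m - i)) ->
  (reciprocal (f + g) == f + g) = (reciprocal f == f).
Proof.
move=> sf sg palg.
have sfg : size (f + g) = m.+1 by rewrite size_polyDl sf.
apply/(self_reciprocalP sfg)/(self_reciprocalP sf) => pal i im.
  by have := pal i im; rewrite !coefD (palg i im) => /addIr.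
by rewrite !coefD (palg i im) pal.
Qed.

(** For even size the symmetry i -> size f - 1 - i has no fixed index, so the coefficients cancel in
    pairs in characteristic 2 and f(1) = 0. *)
Lemma self_reciprocal_odd_size f : reciprocal f = f -> f.[1] = 1 -> odd (size f).
Proof.
move=> rf f1; apply/negPn/negP => even_sf.
have sE : size f = ((size f)./2 + (size f)./2)%N.
  by rewrite addnn even_halfK.
have : f.[1] = 0.
  rewrite horner_coef; under eq_bigr => i _ do rewrite expr1n mulr1.
  rewrite -(big_mkord xpredT (fun i => f`_i)) sE.
  rewrite (@big_cat_nat _ _ _ (size f)./2) ?leq_addr //=.
  rewrite [X in _ + X]big_nat_rev /= -{2}[(size f)./2]add0n big_addn addnK.
  rewrite -big_split big_nat big1 // => i /andP[_ ih].
  set j := (_ - _.+1)%N; have -> : f`_i = f`_j; last exact: addF2.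
  rewrite -{1}rf coef_reciprocal ifT /j; last by move: ih sE; slia.
  by congr (_`_ _); move: ih; rewrite {1}sE; slia.
by rewrite f1 => /eqP; rewrite oner_eq0.
Qed.

(** Reversal turns a factor of [reciprocal P] into a factor of [P] of the same degree, since both
    cofactors have nonzero constant term. *)
Lemma irreducible_reciprocal P : P`_0 = 1 ->
  irreducible_poly P -> irreducible_poly (reciprocal P).
Proof.
move=> P0 [sP irrP]; have P0n : P`_0 != 0 by rewrite P0.
split=> [|q sq /dvdpP[p defP]]; first by rewrite size_reciprocal.
have [p0 q0] : p`_0 != 0 /\ q`_0 != 0.
  apply/andP; rewrite -negb_or -mulf_eq0.
  have := reciprocal0 P; rewrite defP coef0M => ->.
  by rewrite lead_coef_eq0; apply: contraNneq P0n => ->; rewrite coef0.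
have /eqp_size: reciprocal q %= P.
  apply: irrP; rewrite ?size_reciprocal // -[P]reciprocalK // defP reciprocalM.
  exact: dvdp_mull.
rewrite size_reciprocal // => sqP.
rewrite -dvdp_size_eqp ?defP ?dvdp_mull //.
by rewrite -defP size_reciprocal // sqP.
Qed.

(** The condition at 1 excludes the factor X + 1 and so makes all degrees even. *)
Definition sr_root1_free f := [&& reciprocal f == f, f`_0 == 1 & f.[1] == 1].

(** For irreducible [P] with P(0) = 1, the least self-reciprocal multiple; it indexes the Euler
    factors of Z. *)
Definition sr_hull P := if reciprocal P == P then P else P * reciprocal P.

Lemma coef0_dvdp f g : f`_0 = 1 -> g %| f -> g`_0 = 1.
Proof.
move=> f0 /dvdpP[h fE]; apply/eqP; rewrite -F2_neq0.
by apply/eqP => g0; move/eqP: f0; rewrite fE coef0M g0 mulr0.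
Qed.

Lemma horner1_dvdp f g : f.[1] = 1 -> g %| f -> g.[1] = 1.
Proof.
move=> f1 /dvdpP[h fE]; apply/eqP; rewrite -F2_neq0.
by apply/eqP => g1; move/eqP: f1; rewrite fE hornerM g1 mulr0.
Qed.

Lemma reciprocal_dvdp f g : g %| f -> reciprocal g %| reciprocal f.
Proof. by case/dvdpP => h ->; rewrite reciprocalM dvdp_mull. Qed.

Lemma reciprocalX f k : reciprocal (f ^+ k) = reciprocal f ^+ k.
Proof.
elim: k => [|k IHk]; last by rewrite !exprS reciprocalM IHk.
by apply/eqP/(@self_reciprocalP _ 0%N); rewrite ?size_poly1 // => -[].
Qed.

Lemma horner1_reciprocal f : f`_0 = 1 -> (reciprocal f).[1] = f.[1].
Proof.
move=> f0; rewrite !horner_coef size_reciprocal ?f0 //.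
rewrite (reindex_inj rev_ord_inj) /=; apply: eq_bigr => -[i lti] _ /=.
rewrite !expr1n coef_reciprocal ifT; last by slia.
by congr (_`_ _ * _); slia.
Qed.

Lemma lead_coef_F2 f : f != 0 -> lead_coef f = 1.
Proof. by rewrite -lead_coef_eq0 F2_neq0 => /eqP. Qed.

Lemma sr_hullP P : P`_0 = 1 -> P.[1] = 1 -> sr_root1_free (sr_hull P).
Proof.
move=> P0 P1; have P0n : P`_0 != 0 by rewrite P0.
rewrite /sr_root1_free /sr_hull; case: (boolP (_ == P)) => [->|_].
  by rewrite P0 P1.
rewrite reciprocalM reciprocalK // [P * _]mulrC eqxx coef0M hornerM.
rewrite horner1_reciprocal // P0 P1 mulr1 reciprocal0 lead_coef_F2 //.
by apply: contraNneq P0n => ->; rewrite coef0.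
Qed.

Lemma sr_root1_freeM g h :
  sr_root1_free g -> sr_root1_free (g * h) = sr_root1_free h.
Proof.
case/and3P => /eqP rg /eqP g0 /eqP g1.
rewrite /sr_root1_free reciprocalM rg coef0M hornerM g0 g1 !mul1r.
congr (_ && _); apply/eqP/eqP => [/mulfI->//|->//].
by apply/eqP => g00; move/eqP: g0; rewrite g00 coef0.
Qed.

(** Reversal fixes [f], so P^k | f gives P'^k | f for the reciprocal P'; if P' differs from [P] the
    two are coprime, and (P P')^k divides [f]. Divisors of [f] inherit the value 1 at 0 and at 1. *)
Lemma dvdp_sr_hull P f k : irreducible_poly P -> sr_root1_free f ->
  (0 < k)%N ->
  (P ^+ k %| f) = (P`_0 == 1) && (P.[1] == 1) && (sr_hull P ^+ k %| f).
Proof.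
move=> irrP /and3P[/eqP rf /eqP f0 /eqP f1] k0.
apply/idP/andP => [dPf|[_]]; last first.
  rewrite /sr_hull; case: ifP => // _; apply: dvdp_trans.
  by rewrite exprMn dvdp_mulr.
have dP : P %| f by apply: dvdp_trans dPf; rewrite -{1}[P]expr1 dvdp_exp2l.
have P0 := coef0_dvdp f0 dP; rewrite P0 (horner1_dvdp f1 dP).
split=> //; rewrite /sr_hull; case: ifPn => // nrP.
rewrite exprMn Gauss_dvdp ?dPf /=.
  by rewrite -rf -reciprocalX reciprocal_dvdp.
rewrite coprimep_expl // coprimep_expr // irreducible_coprimep //.
  exact: irreducible_reciprocal.
by rewrite eq_sym.
Qed.

End SelfReciprocal.

(** * The weights and the two logarithmic derivatives *)

Section Weights.
Context {R : comNzRingType} (s : R).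
Implicit Types (f g h P : {poly 'F_2}).

Definition slope f : R := s ^+ (f`_1 != 0).

Definition slope2 f : R := slope f * slope (reciprocal f).

Definition const1 f := f`_0 == 1.

Hypothesis s2 : s * s = 1.

(** Linear coefficients add when both constant terms are 1; [s * s = 1] absorbs the case 1 + 1 =
    0. *)
Lemma slopeM f g :
  f`_0 = 1 -> g`_0 = 1 -> slope (f * g) = slope f * slope g.
Proof.
move=> f0 g0; rewrite /slope coefM !big_ord_recl big_ord0 /= f0 g0.
rewrite mul1r mulr1 addr0 -exprD.
by case: (F2P f`_1) (F2P g`_1) => -> [] -> //=; rewrite expr2.
Qed.

Lemma slope_sqr f : slope f * slope f = 1.
Proof. by rewrite /slope; case: (_ != 0); rewrite ?expr1 ?mulr1. Qed.

Lemma slope1 : slope 1 = 1.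
Proof. by rewrite /slope coef1 eqxx. Qed.

Lemma const1_neq0 f : const1 f -> f != 0.
Proof. by apply: contraTneq => ->; rewrite /const1 coef0 eq_sym oner_eq0. Qed.

Lemma reciprocal_const1 f : const1 f -> (reciprocal f)`_0 = 1.
Proof. by move=> /const1_neq0 f0; rewrite reciprocal0 lead_coef_F2. Qed.

Lemma const1M f g : const1 f -> const1 (f * g) = const1 g.
Proof. by rewrite /const1 coef0M => /eqP->; rewrite mul1r. Qed.

Lemma slope2M f g : const1 f -> const1 g -> slope2 (f * g) = slope2 f * slope2 g.
Proof.
move=> f0 g0; rewrite /slope2 reciprocalM slopeM ?slopeM ?reciprocal_const1 //;
  try exact/eqP.
by rewrite mulrACA.
Qed.

Lemma slope2_sr f : reciprocal f = f -> slope2 f = 1.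
Proof. by rewrite /slope2 => ->; exact: slope_sqr. Qed.

Lemma const1_1 : const1 1.
Proof. by rewrite /const1 coef1. Qed.

Lemma reciprocal_1 : reciprocal (1 : {poly 'F_2}) = 1.
Proof. by have := reciprocalX 1 0; rewrite !expr0. Qed.

Lemma slope2_log_derivative M n : (n < M)%N ->
  degree_sum M const1 slope2 n *+ n = \sum_(1 <= m < n.+1)
    degree_sum M const1 slope2 (n - m) * irreducible_sum M const1 id slope2 m.
Proof.
apply: degree_sum_log_derivative.
- exact: const1_neq0.
- by move=> P [].
- move=> P f k irrP f0 k0; apply/idP/andP => [dPf|[]//]; split=> //.
  apply/eqP; apply: coef0_dvdp (eqP f0) _; apply: dvdp_trans dPf.
  by rewrite -{1}[P]expr1 dvdp_exp2l.
- by move=> P h _; apply: const1M.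
- by move=> P h _; apply: slope2M.
- exact: const1_1.
- by rewrite slope2_sr // reciprocal_1.
Qed.

Definition root1_free f := (f`_0 == 1) && (f.[1] == 1).

Lemma slope_log_derivative M n : (n < M)%N ->
  degree_sum M sr_root1_free slope n *+ n = \sum_(1 <= m < n.+1)
    degree_sum M sr_root1_free slope (n - m) *
    irreducible_sum M root1_free sr_hull slope m.
Proof.
apply: degree_sum_log_derivative.
- by move=> f /and3P[_ f0 _]; apply: const1_neq0.
- move=> P irrP /andP[/eqP P0 _]; rewrite /sr_hull; case: ifP => _.
    exact: irrP.1.
  have Pn0 := irredp_neq0 irrP.
  rewrite size_mul ?size_reciprocal ?P0 //; first by move: irrP.1; slia.
  by rewrite -size_poly_gt0 size_reciprocal ?P0 // size_poly_gt0.
- by move=> P f k irrP Cf k0; rewrite dvdp_sr_hull.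
- move=> P h irrP /andP[/eqP P0 /eqP P1].
  by apply: sr_root1_freeM; apply: sr_hullP.
- move=> P h irrP /andP[/eqP P0 /eqP P1] /and3P[_ /eqP h0 _].
  by apply: slopeM => //; have /and3P[_ /eqP] := sr_hullP P0 P1.
- by rewrite /sr_root1_free reciprocal_1 coef1 hornerC !eqxx.
- exact: slope1.
Qed.

End Weights.

(** * Pairing and stripping arguments for degree sums *)

Section Values.
Context {R : comNzRingType} (M : nat).
Implicit Types (f g h P : {poly 'F_2}).

Lemma degree_sum_pred1 (C : pred {poly 'F_2}) (w : {poly 'F_2} -> R) n g : (n < M)%N ->
  (forall f, C f && (size f == n.+1) = (f == g)) ->
  degree_sum M C w n = w g.
Proof.
move=> nM Cg; have := Cg g; rewrite eqxx => /andP[_ /eqP sg].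
rewrite /degree_sum (big_pred1 (npolyp M g)) ?npolypK ?sg // => f /=.
by rewrite Cg -[RHS]val_eqE /= npolypK ?sg.
Qed.

(** Adding [t] is an involution in characteristic 2 that flips the linear coefficient and multiplies
    the weight by [s]. For s = -1 everything cancels; for s = 1 half of the sum is counted twice. *)
Lemma degree_sum_toggle (C : pred {poly 'F_2}) (w : {poly 'F_2} -> R)
    (t : {poly 'F_2}) n s :
  (n < M)%N -> (size t <= n)%N ->
  t`_1 = 1 ->
  (forall f, size f = n.+1 -> C (f + t) = C f) ->
  (forall f, C f -> size f = n.+1 -> w (f + t) = s * w f) ->
  degree_sum M C w n = (1 + s) * \sum_(f : {poly_M 'F_2} |
    [&& C f, size f == n.+1 & f`_1 == 1]) w f.
Proof.
move=> nM st t1 Ct wt.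
have ttK f : f + t + t = f.
  rewrite -addrA (_ : t + t = 0) ?addr0 //; apply/polyP => i.
  by rewrite coefD addF2 coef0.
have sizet f : size f = n.+1 -> size (f + t) = n.+1.
  by move=> sf; rewrite size_polyDl sf.
rewrite mulrDl mul1r /degree_sum (bigID (fun f : {poly_M 'F_2} => f`_1 == 1)) /=.
congr (_ + _); first by apply: eq_bigl => f; rewrite andbA.
rewrite (@big_npoly_bij _ _ _ (fun f => C f && (size f == n.+1) && (f`_1 != 1))
  (fun f => [&& C f, size f == n.+1 & f`_1 == 1]) w (+%R^~ t) (+%R^~ t)).
- by rewrite mulr_sumr; apply: eq_bigr => f /and3P[Cf /eqP sf _]; rewrite wt.
- move=> f sfM /andP[/andP[Cf /eqP sf] f1].
  rewrite Ct // Cf sizet // eqxx ttK nM coefD t1; split=> //.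
  by case: (F2P f`_1) f1 => ->.
- move=> f sfM /and3P[Cf /eqP sf f1].
  rewrite Ct // Cf sizet // eqxx ttK nM coefD t1 (eqP f1); split=> //.
Qed.

(** Stripping [r] and one factor X leads back into [C] in smaller degree; together with the toggle
    this yields a recursion for the counts. *)
Lemma degree_sum_shift (C : pred {poly 'F_2}) m n (r : {poly 'F_2}) :
  (n < m)%N -> (m < M)%N ->
  (forall f, size f = n.+1 -> C f ->
      [/\ C ('X * f + r), size ('X * f + r) = m.+1 & ('X * f + r)`_1 = 1]) ->
  (forall f, C f -> size f = m.+1 -> f`_1 = 1 -> exists2 g, f = 'X * g + r &
      C g && (size g == n.+1)) ->
  \sum_(f : {poly_M 'F_2} | [&& C f, size f == m.+1 & f`_1 == 1]) 1 =
  degree_sum M C (fun=> 1 : R) n.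
Proof.
move=> nm mM Cr Cr'.
rewrite (@big_npoly_bij _ _ _ (fun f => [&& C f, size f == m.+1 & f`_1 == 1])
  (fun g => C g && (size g == n.+1)) (fun=> 1)
  (fun f => 'X * f + r) (fun f => (f - r) %/ 'X)) //.
- move=> f sfM /and3P[Cf /eqP sf /eqP f1].
  have [g -> Cg] := Cr' f Cf sf f1.
  rewrite addrK ['X * g]mulrC mulpK ?polyX_eq0 // Cg; case/andP: Cg => _ /eqP->.
  by split; [|apply: ltn_trans mM|rewrite mulrC].
- move=> f sfM /andP[Cf /eqP sf].
  have [-> -> ->] := Cr f sf Cf; rewrite !eqxx mM; split=> //.
  by rewrite addrK mulrC mulpK ?polyX_eq0.
Qed.

End Values.

(** * The two L-functions *)

Section DegreeSums.
Context {R : comNzRingType} (M : nat).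
Implicit Types (f g h P : {poly 'F_2}) (s : R).

Lemma slope_toggle s f g : s * s = 1 -> g`_1 = 1 ->
  slope s (f + g) = s * slope s f.
Proof.
move=> s2 g1; rewrite /slope coefD g1.
by case: (F2P f`_1) => -> /=; rewrite ?mulr1 ?expr1 ?s2.
Qed.

Lemma slope_one : slope (1 : R) =1 fun=> 1.
Proof. by move=> f; apply: expr1n. Qed.

Lemma slope2_one : slope2 (1 : R) =1 fun=> 1.
Proof. by move=> f; rewrite /slope2 !slope_one mulr1. Qed.

Lemma const1_size1 f : const1 f && (size f == 1%N) = (f == 1).
Proof.
apply/andP/eqP => [[/eqP f0 /eqP sf]|->]; last by rewrite size_poly1 const1_1.
by rewrite (size1_polyC (eq_leq sf)) f0.
Qed.

Lemma lead_coef_size f n : size f = n.+1 -> f`_n = 1.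
Proof.
move=> sf; have := @lead_coef_F2 f; rewrite lead_coefE sf; apply.
by rewrite -size_poly_gt0 sf.
Qed.

Lemma const1_size2 f : const1 f && (size f == 2) = (f == 'X + 1).
Proof.
apply/andP/eqP => [[/eqP f0 /eqP sf]|->]; last first.
  by rewrite /const1 coefD coefX coef1 size_XaddC.
apply/polyP => -[|[|i]]; rewrite coefD coefX coef1 /= ?f0 ?add0r ?addr0 //.
  by rewrite (lead_coef_size sf).
by rewrite nth_default // sf.
Qed.

Lemma const1_addX f : const1 (f + 'X) = const1 f.
Proof. by rewrite /const1 coefD coefX addr0. Qed.

Lemma slope2_sum0 s : (0 < M)%N -> s * s = 1 ->
  degree_sum M const1 (slope2 s) 0 = 1.
Proof.
move=> M0 s2; rewrite (degree_sum_pred1 _ M0 const1_size1).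
by rewrite slope2_sr // reciprocal_1.
Qed.

Lemma slope2_sum1 s : (1 < M)%N -> s * s = 1 ->
  degree_sum M const1 (slope2 s) 1 = 1.
Proof.
move=> M1 s2; rewrite (degree_sum_pred1 _ M1 const1_size2).
rewrite slope2_sr //; apply/eqP/(@self_reciprocalP _ 1).
  by rewrite size_XaddC.
by move=> [|[|//]] _; rewrite !coefD !coefX !coef1 ?addr0 ?add0r.
Qed.

(** Toggling the linear coefficient gives a factor 2, and f -> (f - 1)/X lowers the degree by
    one. *)
Lemma degree_sum_const1 n : (n.+1 < M)%N ->
  degree_sum M const1 (fun=> 1 : R) n.+1 = 2 ^+ n.
Proof.
elim: n => [|n IHn] nM.
  rewrite expr0; apply: etrans (slope2_sum1 nM (mulr1 1)).
  by apply: eq_bigr => f _; rewrite slope2_one.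
rewrite (@degree_sum_toggle _ _ _ _ 'X _ 1) ?size_polyX ?coefX //; first last.
- by move=> *; rewrite mulr1.
- by move=> f _; apply: const1_addX.
rewrite (degree_sum_shift (r := 1) (ltnSn n.+1)) ?IHn ?exprS //; first last.
- move=> f /eqP f0 sf f1; exists (\poly_(i < n.+2) f`_i.+1); last first.
    rewrite /const1 coef_poly /= f1 eqxx size_poly_eq ?eqxx //.
    by rewrite (lead_coef_size sf).
  apply/polyP => -[|i]; rewrite coefD coefXM coef1 /= ?f0 ?add0r // addr0 coef_poly.
  by case: ltnP => // le; rewrite nth_default // sf.
- move=> f sf /eqP f0; rewrite /const1 !coefD !coefXM !coef1 /= add0r addr0 f0.
  have f00 : f != 0 by rewrite -size_poly_gt0 sf.
  have sXf : size ('X * f) = n.+3 by rewrite mulrC size_mulX ?sf.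
  by split=> //; rewrite size_polyDl sXf // size_poly1.
- by apply: ltn_trans nM.
Qed.

Lemma slope2_sum_one n : (n.+1 < M)%N ->
  degree_sum M const1 (slope2 (1 : R)) n.+1 = 2 ^+ n.
Proof.
move=> nM; rewrite -degree_sum_const1 //.
by apply: eq_bigr => f _; rewrite slope2_one.
Qed.

(** In degree 2 both end coefficients are 1, so every such polynomial is self-reciprocal and has
    weight 1. *)
Lemma slope2_sum2 s : (2 < M)%N -> s * s = 1 ->
  degree_sum M const1 (slope2 s) 2 = 2.
Proof.
move=> M2 s2; rewrite -[RHS]expr1 -degree_sum_const1 //.
apply: eq_bigr => f /andP[/eqP f0 /eqP sf]; rewrite slope2_sr //.
apply/eqP/(self_reciprocalP sf) => -[|[|[|//]]] // _.
  by rewrite f0 (lead_coef_size sf).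
by rewrite f0 (lead_coef_size sf).
Qed.

Lemma slope2_sum_minus_one n : (n.+3 < M)%N ->
  degree_sum M const1 (slope2 (- 1 : R)) n.+3 = 0.
Proof.
move=> nM.
rewrite (@degree_sum_toggle _ _ _ _ 'X _ (-1)) ?size_polyX ?coefX //.
- by rewrite subrr mul0r.
- by move=> f _; apply: const1_addX.
move=> f f0 sf; rewrite /slope2 slope_toggle ?coefX ?mulrNN ?mulr1 //.
rewrite -mulrA; congr (_ * (_ * _)).
(* The linear coefficient of the reciprocal is the one of index [n.+2], which adding ['X] leaves
   alone. *)
by rewrite /slope !coef_reciprocal size_polyDl ?sf ?size_polyX //= coefD coefX addr0.
Qed.

Lemma sr_root1_free_size1 f : sr_root1_free f && (size f == 1%N) = (f == 1).
Proof.
rewrite -const1_size1 /sr_root1_free /const1.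
apply/andP/andP => [[/and3P[_ -> _]]//|[/eqP f0 /eqP sf]].
have -> : f = 1 by apply/eqP; rewrite -const1_size1 /const1 f0 sf !eqxx.
by rewrite reciprocal_1 coef1 hornerC size_poly1 !eqxx.
Qed.

Lemma size_X2X1 : size ('X^2 + 'X + 1 : {poly 'F_2}) = 3.
Proof. by rewrite -addrA size_polyDl ?size_polyXn ?size_XaddC. Qed.

Lemma sr_root1_free_size3 f :
  sr_root1_free f && (size f == 3) = (f == 'X^2 + 'X + 1).
Proof.
apply/andP/eqP => [[/and3P[/eqP rf /eqP f0 /eqP f1] /eqP sf]|->].
  have f2 := lead_coef_size sf.
  (* In f(1) = f_0 + f_1 + f_2 the two end coefficients cancel. *)
  have f11 : f`_1 = 1.
    rewrite -f1 horner_coef sf !big_ord_recr big_ord0 /= !expr1n !mulr1.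
    by rewrite add0r f0 f2 addrAC addF2 add0r.
  apply/polyP => -[|[|[|i]]]; rewrite !coefD coefXn coefX coef1 /=
    ?f0 ?f11 ?f2 ?addr0 ?add0r //.
  by rewrite nth_default // sf.
rewrite size_X2X1 /sr_root1_free !hornerD hornerXn hornerX hornerC expr1n addF2.
rewrite add0r !coefD coefXn coefX coef1 !add0r !eqxx !andbT; split=> //.
apply/(self_reciprocalP size_X2X1) => -[|[|[|//]]] _;
  by rewrite !coefD !coefXn !coefX !coef1 /= ?addr0 ?add0r.
Qed.

Lemma slope_sum0 s : (0 < M)%N -> degree_sum M sr_root1_free (slope s) 0 = 1.
Proof.
by move=> M0; rewrite (degree_sum_pred1 _ M0 sr_root1_free_size1) slope1.
Qed.

Lemma slope_sum2 s : (2 < M)%N -> degree_sum M sr_root1_free (slope s) 2 = s.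
Proof.
move=> M2; rewrite (degree_sum_pred1 _ M2 sr_root1_free_size3).
by rewrite /slope !coefD coefXn coefX coef1 /= ?add0r ?addr0 expr1.
Qed.

Lemma slope_sum_odd s n : odd n -> degree_sum M sr_root1_free (slope s) n = 0.
Proof.
move=> on; apply: big_pred0 => f; apply/negP.
case/andP=> /and3P[/eqP rf _ /eqP f1] /eqP sf.
by have := self_reciprocal_odd_size rf f1; rewrite sf /= on.
Qed.

Lemma degree_sum_sr_toggle (w : {poly 'F_2} -> R) s n : (n.+2.*2 < M)%N ->
  (forall f g, g`_1 = 1 -> w (f + g) = s * w f) ->
  degree_sum M sr_root1_free w n.+2.*2 = (1 + s) * \sum_(f : {poly_M 'F_2} |
    [&& sr_root1_free f, size f == n.+2.*2.+1 & f`_1 == 1]) w f.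
Proof.
(* The linear coefficient and its mirror image are flipped together, which keeps palindromes and the
   value at 1. The two positions are distinct from degree 4 on. *)
move=> nM wt; pose t : {poly 'F_2} := 'X + 'X^(n.+1.*2.+1).
have t1 : t`_1 = 1 by rewrite /t coefD coefX coefXn /= addr0.
apply: (degree_sum_toggle (t := t)) => //.
- rewrite (leq_trans (size_polyD _ _)) // geq_max size_polyX size_polyXn.
  by lia.
- move=> f sf; rewrite /sr_root1_free hornerD /t hornerD hornerX hornerXn.
  rewrite expr1n addF2 addr0 -/t (self_reciprocalD sf).
  + by rewrite coefD coefD coefX coefXn !addr0.
  + rewrite (leq_trans (size_polyD _ _)) // geq_max size_polyX size_polyXn.
    by lia.
  move=> i im; rewrite !coefD !coefX !coefXn addrC.
  by congr (_%:R + _%:R); apply/eqP/eqP; lia.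
- by move=> f _ _; apply: wt.
Qed.

(** The border 1 + X^m is palindromic and vanishes at 1, so self-reciprocity and the value at 1
    carry over from [f]. *)
Lemma sr_root1_free_shift f k m : m = k.+2 -> size f = k.+1 ->
  sr_root1_free f ->
  [/\ sr_root1_free ('X * f + (1 + 'X^m)), size ('X * f + (1 + 'X^m)) = m.+1
    & ('X * f + (1 + 'X^m))`_1 = 1].
Proof.
move=> mk sf /and3P[rf /eqP f0 /eqP f1].
have m0 : (m == 0%N) = false by rewrite mk.
have m0' : (0%N == m) = false by rewrite mk.
have sF : size ('X * f + (1 + 'X^m)) = m.+1.
  have f00 : f != 0 by rewrite -size_poly_gt0 sf.
  rewrite addrA addrC size_polyDl size_polyXn // ltnS.
  rewrite (leq_trans (size_polyD _ _)) // geq_max mulrC size_mulX // sf.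
  by rewrite size_poly1 mk ltnSn.
split=> //; last first.
  by rewrite !coefD coefXM coef1 coefXn f0 mk !addr0.
rewrite /sr_root1_free !hornerD hornerM hornerX hornerXn hornerC mul1r f1.
rewrite expr1n addF2 addr0 !coefD coefXM coef1 coefXn m0' add0r addr0.
rewrite !eqxx !andbT; apply/(self_reciprocalP sF) => i im.
rewrite !coefD !coefXM !coef1 !coefXn.
have [->|i0] := eqVneq i 0%N.
  by rewrite subn0 eqxx ?m0 ?m0' ?eqxx ?add0r [f`__]nth_default ?add0r ?addr0 // sf mk.
have [->|im'] := eqVneq i m.
  by rewrite subnn eqxx ?m0 ?m0' ?eqxx ?add0r [f`__]nth_default ?add0r ?addr0 // sf mk.
rewrite !ifF; [|lia..].
rewrite (_ : (m - i == m)%N = false) ?addr0; last lia.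
rewrite (_ : (m - i == 0)%N = false) ?addr0; last lia.
by rewrite (self_reciprocalP sf rf); [congr (_`_ _)|]; lia.
Qed.

(** The linear coefficient 1 and its mirror image become the constant and the leading coefficient of
    the inner polynomial. *)
Lemma sr_root1_free_unshift f k m : m = k.+2 -> (0 < k)%N ->
  sr_root1_free f -> size f = m.+1 -> f`_1 = 1 ->
  exists2 g, f = 'X * g + (1 + 'X^m) & sr_root1_free g && (size g == k.+1).
Proof.
move=> mk k0 /and3P[rf /eqP f0 /eqP f1] sf f11.
have pal i := self_reciprocalP sf rf i.
have ft := lead_coef_size sf.
have fE : f = 'X * \poly_(i < k.+1) f`_i.+1 + (1 + 'X^m).
  apply/polyP => i; rewrite !coefD coefXM coef1 coefXn coef_poly.
  have [->|i0] := eqVneq i 0%N.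
    by rewrite f0 mk add0r addr0.
  have [->|im] := eqVneq i m; first by rewrite ft mk ltnn !add0r.
  rewrite !addr0 prednK ?lt0n //; case: ltnP => // ki.
  by rewrite nth_default // sf; lia.
have sg : size (\poly_(i < k.+1) f`_i.+1) = k.+1.
  rewrite size_poly_eq // pal; last by lia.
  by rewrite mk subSnn f11 oner_eq0.
exists (\poly_(i < k.+1) f`_i.+1) => //.
rewrite sg eqxx andbT; apply/and3P; split.
- apply/(self_reciprocalP sg) => i im; rewrite !coef_poly !ifT; [|lia..].
  by rewrite pal; [congr (_`_ _)|]; lia.
- by rewrite coef_poly /= f11 eqxx.
- move: f1; rewrite {1}fE !hornerD hornerM hornerX hornerXn hornerC mul1r.
  by rewrite expr1n addF2 addr0 => ->.
Qed.

Lemma degree_sum_sr n : (n.+1.*2 < M)%N ->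
  degree_sum M sr_root1_free (fun=> 1 : R) n.+1.*2 = 2 ^+ n.
Proof.
elim: n => [|n IHn] nM.
  rewrite expr0; apply: etrans (slope_sum2 1 nM).
  by apply: eq_bigr => f _; rewrite slope_one.
rewrite (degree_sum_sr_toggle nM (s := 1)); last by move=> *; rewrite mulr1.
have n2 : (n.+1.*2 < n.+2.*2)%N by rewrite ltn_double.
have mk : n.+2.*2 = n.+1.*2.+2 by [].
rewrite (degree_sum_shift (r := 1 + 'X^(n.+2.*2)) n2 nM).
- by rewrite IHn ?exprS // (ltn_trans n2 nM).
- by move=> f sf Cf; apply: sr_root1_free_shift mk sf Cf.
- by move=> f Cf sf; apply: (sr_root1_free_unshift mk).
Qed.

Lemma slope_sum_one n : (n.+1.*2 < M)%N ->
  degree_sum M sr_root1_free (slope (1 : R)) n.+1.*2 = 2 ^+ n.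
Proof.
move=> nM; rewrite -degree_sum_sr //.
by apply: eq_bigr => f _; rewrite slope_one.
Qed.

Lemma slope_sum_minus_one n : (n.+2.*2 < M)%N ->
  degree_sum M sr_root1_free (slope (- 1 : R)) n.+2.*2 = 0.
Proof.
move=> nM; rewrite (degree_sum_sr_toggle nM (s := -1)) ?subrr ?mul0r //.
by move=> f g; apply: slope_toggle; rewrite mulrNN mulr1.
Qed.

End DegreeSums.

(** * Newton identities for the generating functions that occur *)

Section PowerSums.
Context {R : numFieldType} (N : nat) (S K : nat -> R).
Hypothesis SK : forall n, (n <= N)%N ->
  S n *+ n = \sum_(1 <= m < n.+1) S (n - m)%N * K m.
Hypothesis S0 : S 0%N = 1.

Lemma power_sum_top n : (n < N)%N ->
  K n.+1 = S n.+1 *+ n.+1 - \sum_(1 <= m < n.+1) S (n.+1 - m)%N * K m.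
Proof.
by move=> nN; rewrite SK // big_nat_recr //= subnn S0 mul1r addrAC subrr add0r.
Qed.

(** The series is (1 - T)/(1 - 2T), with T L'/L = 2T/(1 - 2T) - T/(1 - T). *)
Lemma power_sum_geometric :
  (forall n, (n < N)%N -> S n.+1 = 2 ^+ n) ->
  forall n, (0 < n <= N)%N -> K n = 2 ^+ n - 1.
Proof.
move=> S_ [//|n]; elim: n => [|n IHn] /= nN.
  by rewrite power_sum_top // big_geq // S_ //= subr0 expr1 mulr1n; ring.
have nN' := ltnW nN; rewrite power_sum_top // S_ // big_nat_recr //= subSnn S_ //.
  have := SK nN'; rewrite big_nat_recr //= subnn S0 S_ //.
  (* From index 1 on [S] doubles at each step, so twice the preceding identity evaluates all but the
     last terms. *)
  have -> : \sum_(1 <= m < n.+1) S (n.+2 - m)%N * K m =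
            2 * \sum_(1 <= m < n.+1) S (n.+1 - m)%N * K m.
    rewrite mulr_sumr; apply: eq_big_nat => m /andP[m0 mn].
    have -> : (n.+2 - m = (n - m).+2)%N by lia.
    have -> : (n.+1 - m = (n - m).+1)%N by lia.
    by rewrite !S_ ?exprS ?mulrA //; lia.
  rewrite IHn //; rewrite expr0 !exprS => E.
  move: E; set X := \sum_(_ <= _ < _) _ => E.
  have {E} -> : X = (2 ^+ n) *+ n.+1 - (2 * 2 ^+ n - 1) by rewrite E; ring.
  by rewrite [in LHS]mulrS -[_ *+ n.+1]mulr_natr; ring.
by apply: leq_ltn_trans nN.
Qed.

(** The series is 1 - T, with T L'/L = -T/(1 - T). *)
Lemma power_sum_linear : S 1%N = -1 ->
  (forall n, (n.+1 < N)%N -> S n.+2 = 0) ->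
  forall n, (0 < n <= N)%N -> K n = -1.
Proof.
move=> S1 S_ [//|n]; elim: n => [|n IHn] /= nN.
  by rewrite power_sum_top // big_geq // S1 subr0 mulr1n.
have nN' := ltnW nN; rewrite power_sum_top // S_ // mul0rn sub0r.
rewrite big_nat_recr //= subSnn S1 IHn // big_nat big1 ?add0r ?mulrNN ?mulr1 //.
move=> m /andP[m0 mn]; have -> : (n.+2 - m = (n - m).+2)%N by lia.
by rewrite S_ ?mul0r //; lia.
Qed.

(** The series is 1 + T + 2T^2; clearing the denominator in T L'/L = (T + 4T^2)/(1 + T + 2T^2) gives
    the recurrence. *)
Lemma power_sum_quadratic : S 1%N = 1 -> S 2%N = 2 ->
  (forall n, (n.+2 < N)%N -> S n.+3 = 0) ->
  [/\ (0 < N)%N -> K 1%N = 1, (1 < N)%N -> K 2%N = 3 &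
    forall n, (n.+2 < N)%N -> K n.+3 = - K n.+2 - 2 * K n.+1].
Proof.
move=> S1 S2 S_.
have K1 : (0 < N)%N -> K 1%N = 1.
  by move=> N0; rewrite power_sum_top // big_geq // S1 subr0 mulr1n.
split=> [//|N1|n nN].
  rewrite power_sum_top // big_nat1 S1 S2 K1 ?(ltnW N1) //.
  by rewrite -mulr_natr; ring.
rewrite power_sum_top // S_ // mul0rn sub0r 2?big_nat_recr //=.
rewrite subSnn S1 (_ : n.+3 - n.+1 = 2)%N ?S2; last lia.
rewrite big_nat big1; first by ring.
move=> m /andP[m0 mn]; have -> : (n.+3 - m = (n - m).+3)%N by lia.
by rewrite S_ ?mul0r //; lia.
Qed.

End PowerSums.

Lemma big_nat_double (R : nmodType) n (F : nat -> R) :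
  (forall m, odd m -> (m < n.*2)%N -> F m = 0) ->
  \sum_(1 <= m < n.*2.+1) F m = \sum_(1 <= m < n.+1) F m.*2.
Proof.
elim: n => [|n IHn] Fodd; first by rewrite !big_geq.
rewrite doubleS big_nat_recr //= big_nat_recr //= [RHS]big_nat_recr //=.
rewrite IHn => [|m om mn]; last by rewrite Fodd // doubleS; lia.
by rewrite [F n.*2.+1]Fodd ?addr0 //= ?odd_double // doubleS.
Qed.

(** * Self-reciprocal irreducibles *)

Section SelfReciprocalCount.
Context {R : comNzRingType} (M : nat) (s : R).
Hypothesis s2 : s * s = 1.
Implicit Types (P : {poly 'F_2}).

Definition sr_irreducible_sum d : R :=
  \sum_(P : {poly_M 'F_2} | [&& irreducibleb P, reciprocal P == P :> {poly _}
    & size P == d.*2.+1]) slope s P.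

Lemma big_nat_mul_eq (F : nat -> R) d m : (0 < d)%N -> (0 < m < M)%N ->
  \sum_(1 <= k < M | (k * d == m)%N) F k = if (d %| m)%N then F (m %/ d)%N else 0.
Proof.
move=> d0 /andP[m0 mM]; case: ifPn => [dm|ndm]; last first.
  by apply: big_pred0 => k; apply: contraNF ndm => /eqP<-; apply: dvdn_mull.
rewrite big_nat_cond (big_rem (m %/ d)%N) /=; last first.
  rewrite mem_index_iota divn_gt0 // dvdn_leq //=.
  by apply: leq_ltn_trans mM; apply: leq_div.
rewrite divnK // eqxx divn_gt0 // dvdn_leq // (leq_ltn_trans (leq_div _ _) mM) /=.
rewrite big1_seq ?addr0 // => k /andP[/andP[_ /eqP <-]].
by rewrite mulnK // mem_rem_uniqF // iota_uniq.
Qed.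

Lemma irreducible_root1 P : irreducible_poly P -> P.[1] != 1 -> P = 'X + 1.
Proof.
move=> irrP P1; have {}P1 : root P 1 by rewrite /root; case: (F2P P.[1]) P1 => ->.
have XE : 'X - 1%:P = 'X + 1 :> {poly 'F_2}.
  by congr (_ + _); rewrite -polyCN; congr (_%:P); apply: val_inj.
rewrite -XE; apply/esym/eqp_F2; apply: irrP.2; last by rewrite dvdp_XsubCl.
by rewrite size_XsubC.
Qed.

Lemma irreducible_X1 : irreducible_poly ('X + 1 : {poly 'F_2}).
Proof. exact: irredp_XaddC. Qed.

Lemma self_reciprocal_const1 P : irreducible_poly P -> reciprocal P = P ->
  P`_0 = 1.
Proof. by move=> /irredp_neq0 P0 <-; rewrite reciprocal0 lead_coef_F2. Qed.

(** Among irreducibles with constant term 1 only X + 1 vanishes at 1; it has degree 1 and weight 1,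
    so just the exponent k = m contributes. *)
Lemma slope2_irreducible_sum m : (0 < m)%N -> (m.*2 < M)%N ->
  irreducible_sum M const1 id (slope2 s) m = 1 +
  \sum_(P : {poly_M 'F_2} | irreducibleb P && root1_free P)
    (\sum_(1 <= k < M | (k * (size P).-1 == m)%N) slope2 s P ^+ k) *+ (size P).-1.
Proof.
move=> m0 mM; have M2 : (2 <= M)%N by lia.
rewrite /irreducible_sum (bigID (fun P : {poly_M 'F_2} => P.[1] == 1)) addrC /=.
congr (_ + _); first by apply: eq_big => [P|P _] //; rewrite -andbA.
rewrite (big_pred1 (npolyp M ('X + 1))) => [|P /=].
  rewrite npolypK ?size_XaddC // big_nat_mul_eq ?dvd1n ?divn1; [|lia..].
  rewrite slope2_sr ?expr1n // => //.
  apply/eqP/(@self_reciprocalP _ 1); first by rewrite size_XaddC.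
  by move=> [|[|//]] _; rewrite !coefD !coefX !coef1 ?addr0 ?add0r.
rewrite -[RHS]val_eqE /= npolypK ?size_XaddC //.
apply/idP/eqP => [/andP[/andP[/irreducibleP iP _]]|->].
  exact: irreducible_root1.
rewrite /const1 coefD coefX coef1 hornerD hornerX hornerC addF2 add0r eqxx.
by rewrite eq_sym oner_eq0; have /irreducibleP -> := irreducible_X1.
Qed.

(* Even powers of a self-reciprocal [P] have weight 1, and [P * reciprocal P] has
   the weight [slope2 P]; both cancel against the irreducible sum of [slope2],
   where ['X + 1] accounts for the summand 1. *)
Theorem sr_irreducible_sumE m : (0 < m)%N -> (m.*2 < M)%N ->
  \sum_(1 <= d < m.+1 | ((d %| m) && odd (m %/ d))%N)
    sr_irreducible_sum d *+ d.*2 =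
  irreducible_sum M root1_free sr_hull (slope s) m.*2
    - irreducible_sum M const1 id (slope2 s) m + 1.
Proof.
move=> m0 mM; rewrite slope2_irreducible_sum // opprD addrCA addrAC addNr add0r.
rewrite /irreducible_sum -sumrB.
transitivity (\sum_(P : {poly_M 'F_2} | irreducibleb P && root1_free P)
   \sum_(1 <= d < m.+1 | ((d %| m) && odd (m %/ d))%N)
     if (reciprocal P == P :> {poly _}) && (size P == d.*2.+1)
     then slope s P *+ d.*2 else 0).
  rewrite exchange_big /=; apply: eq_bigr => d _.
  rewrite /sr_irreducible_sum -sumrMnl -big_mkcondr /=.
  apply: eq_bigl => P; rewrite -andbA; case iP: (irreducibleb P) => //=.
  have {}iP := irreducibleP _ iP.
  apply/idP/idP => [/andP[/eqP rP /eqP sP]|/andP[_ //]].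
  rewrite rP sP !eqxx !andbT /root1_free (self_reciprocal_const1 iP rP) eqxx /=.
  (* X + 1 is excluded by its odd degree. *)
  apply/negPn/negP => /(irreducible_root1 iP) PE.
  by move: sP; rewrite PE size_XaddC => -[]; lia.
apply: eq_bigr => P /andP[/irreducibleP iP /andP[/eqP P0 /eqP P1]].
rewrite -mulrnBl.
(* For P different from its reciprocal P', the hull P P' has degree 2 deg P and weight [slope2 P],
   so its terms at 2m match those of [P] at [m]. *)
rewrite /sr_hull; case: eqP => [rP|_]; last first.
  rewrite big1 // size_mul ?irredp_neq0 //; last first.
    exact: irreducible_reciprocal.
  rewrite size_reciprocal ?P0 //.
  rewrite (_ : (_ + _).-1.-1 = (size P).-1.*2); last by move: iP.1; slia.
  rewrite [X in X - _](eq_bigl (fun k => (k * (size P).-1 == m)%N)) => [|k].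
    rewrite slopeM ?subrr ?mul0rn // reciprocal_const1 //; exact/eqP.
  by rewrite -doubleMr; apply/eqP/eqP => [/double_inj|->].
(* For self-reciprocal [P] of degree 2d, the first sum has the term [slope s P] to the power m/d if
   d | m, the second the term 1 if 2d | m. They cancel for m/d even, and [slope s P] is left for m/d
   odd. *)
have oP := self_reciprocal_odd_size rP P1.
pose d := (size P)./2.
have sPd : size P = d.*2.+1 by rewrite /d -[LHS]odd_double_half oP.
have d0 : (0 < d)%N by have := iP.1; rewrite sPd; lia.
rewrite sPd /= !big_nat_mul_eq ?double_gt0 //; [|lia..].
rewrite slope2_sr // expr1n -!muln2 dvdn_pmul2r // divnMr //.
transitivity (\sum_(1 <= i < m.+1 | i == d)
    (if ((i %| m) && odd (m %/ i))%N then slope s P *+ (i * 2) else 0)).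
  rewrite big_mkcond [RHS]big_mkcond; apply: eq_bigr => i _.
  have -> : ((d * 2).+1 == i.*2.+1) = (i == d) by apply/eqP/eqP; lia.
  by rewrite -muln2; case: (i == d); case: ((_ %| _) && _)%N.
rewrite big_nat1_eq d0 ltnS.
have [dm|ndm] := boolP (d %| m)%N; last first.
  have -> : (d * 2 %| m)%N = false.
    by apply: contraNF ndm; apply: dvdn_trans; apply: dvdn_mulr.
  by rewrite subrr mul0rn; case: ifP.
rewrite dvdn_leq // -[in X in _ - X](divnK dm) [(d * 2)%N]mulnC dvdn_pmul2r //.
rewrite dvdn2; have -> : slope s P ^+ (m %/ d) = slope s P ^+ odd (m %/ d).
  rewrite -{1}[(m %/ d)%N]odd_double_half -mul2n exprD exprM expr2.
  by rewrite slope_sqr // expr1n mulr1.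
by case: odd => /=; rewrite ?subr0 // subrr mul0rn.
Qed.

End SelfReciprocalCount.

(** * Moebius inversion and the closed form *)

Section Moebius.
Local Open Scope nat_scope.

Lemma moebius_prime_mul p i : prime p -> 0 < i -> ~~ (p %| i) ->
  moebius (p * i) = (- moebius i)%R.
Proof.
move=> pp i0 npi; have p0 := prime_gt0 pp.
have lp : logn p i = 0.
  by apply/eqP; rewrite -leqn0 leqNgt -pfactor_dvdn.
have primesE : perm_eq (primes (p * i)) (p :: primes i).
  apply: uniq_perm; rewrite ?primes_uniq //=.
    by rewrite primes_uniq mem_primes (negPf npi) !andbF.
  by move=> q; rewrite primesM // inE primes_prime // inE.
rewrite /moebius muln_eq0 (gtn_eqF p0) (gtn_eqF i0) /=.
rewrite (perm_all _ primesE) (perm_size primesE) /= lognM // lp addn0.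
rewrite logn_prime // eqxx /=.
have -> : all (fun q => logn q (p * i) == 1) (primes i) =
          all (fun q => logn q i == 1) (primes i).
  apply: eq_in_all => q; rewrite mem_primes => /and3P[qp _ qi].
  rewrite lognM // logn_prime // (_ : (q == p) = false) //.
  by apply: contraNF npi => /eqP<-.
by case: ifP => _; rewrite ?oppr0 // exprS mulN1r.
Qed.

Lemma moebius_square_dvd p n : prime p -> p ^ 2 %| n -> moebius n = 0%R.
Proof.
move=> pp p2n; rewrite /moebius; case: eqP => // /eqP; rewrite -lt0n => n0.
case: allP => // /(_ p).
rewrite mem_primes pp n0 (dvdn_trans _ p2n) ?dvdn_exp // => /(_ isT) /eqP ln.
by move: p2n; rewrite pfactor_dvdn // ln.
Qed.

(** For a prime p dividing [e], divisors divisible by p^2 contribute 0, and the divisors p i with i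
    prime to p cancel against the i. *)
Lemma sum_moebius e N : 0 < e < N ->
  (\sum_(j < N | (j %| e)%N) moebius j = (e == 1)%:R)%R.
Proof.
case: N => [|N]; first by rewrite ltn0 andbF.
case/andP=> e0 eN; have [->|e1] := eqVneq e 1.
  rewrite (big_pred1 (inord 1)) => [|j].
    by rewrite inordK ?(leq_trans _ eN).
  rewrite /= -[RHS]val_eqE /= inordK ?dvdn1 //.
  exact: leq_ltn_trans e0 eN.
have e2 : 1 < e by rewrite ltn_neqAle eq_sym e1.
pose p := pdiv e; have pp : prime p := pdiv_prime e2.
have pe : p %| e := pdiv_dvd e.
have p0 := prime_gt0 pp.
rewrite (bigID (fun j : 'I_N.+1 => p %| j)) /=.
rewrite (bigID (fun j : 'I_N.+1 => p ^ 2 %| j)) /= big1 ?add0r; last first.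
  by move=> j /andP[_ p2j]; apply: moebius_square_dvd pp p2j.
rewrite (reindex_onto (fun i : 'I_N.+1 => inord (p * i))
                      (fun i : 'I_N.+1 => inord (i %/ p))) /=; last first.
  move=> j /andP[/andP[je pj] _].
  rewrite inordK; first by rewrite mulnC divnK // inord_val.
  by apply: leq_ltn_trans (ltn_ord j); apply: leq_div.
rewrite -[X in (X + _)%R]opprK -sumrN addrC; apply/eqP; rewrite subr_eq0; apply/eqP.
have dvd_pi (i : nat) : ~~ (p %| i) -> (p * i %| e) = (i %| e).
  by move=> npi; rewrite Gauss_dvd ?pe // prime_coprime.
have le_pi i : p * i %| e -> p * i < N.+1.
  by move=> pie; apply: leq_ltn_trans eN; apply: dvdn_leq.
apply/esym; apply: eq_big => [i|i /andP[/andP[/andP[pie _] npi] /eqP iE]].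
  (* Out of range, [inord] returns 0, which does not divide [e]; such [i] drop out on both sides. *)
  have [piN|Npi] := ltnP (p * i) N.+1; last first.
    have -> : inord (p * i) = ord0 :> 'I_N.+1.
      by rewrite /inord /insubd insubN // -leqNgt.
    rewrite /= dvd0n (gtn_eqF e0) /=; apply/esym/negP => /andP[ie npi].
    by move: Npi; rewrite leqNgt le_pi // dvd_pi.
  rewrite inordK // mulKn // inord_val eqxx andbT dvdn_mulr // andbT.
  rewrite -mulnn dvdn_pmul2l //.
  by case: (boolP (p %| i)) => npi; rewrite ?andbF // !andbT dvd_pi.
have [piN|Npi] := ltnP (p * i) N.+1; last first.
  by move: pie; rewrite /inord /insubd insubN -?leqNgt //= dvd0n (gtn_eqF e0).
rewrite inordK // in pie npi *.
have {}npi : ~~ (p %| i) by rewrite -(dvdn_pmul2l p0) mulnn.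
rewrite moebius_prime_mul ?opprK //.
by move: pie; rewrite dvd_pi // => /(dvdn_gt0 e0).
Qed.

End Moebius.

(** After exchanging the sums, [c d] is multiplied by the sum of [moebius j] over all j | n/d: as
    n/d is odd, its divisors satisfy the parity conditions automatically. Only d = n survives. *)
Lemma moebius_inversion_odd (R : comNzRingType) (A c : nat -> R) n :
  (0 < n)%N ->
  (forall m, (0 < m <= n)%N ->
     A m = \sum_(1 <= d < m.+1 | ((d %| m) && odd (m %/ d))%N) c d) ->
  \sum_(j <- divisors n | odd j) (moebius j)%:~R * A (n %/ j)%N = c n.
Proof.
move=> n0 Ac.
transitivity (\sum_(1 <= j < n.+1 | ((j %| n) && odd j)%N)
    \sum_(1 <= d < n.+1 | ((d %| n %/ j) && odd (n %/ j %/ d))%N)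
      (moebius j)%:~R * c d).
  have -> : divisors n = [seq j <- index_iota 1 n.+1 | (j %| n)%N].
    apply: (@sorted_eq _ ltn); first exact: ltn_trans.
    - by move=> a b; lia.
    - exact: sorted_divisors_ltn.
    - by apply: sorted_filter; [exact: ltn_trans|exact: iota_ltn_sorted].
    apply: uniq_perm; rewrite ?divisors_uniq ?filter_uniq ?iota_uniq // => j.
    rewrite mem_filter mem_index_iota -dvdn_divisors //.
    by case: (boolP (j %| n)%N) => //= jn; rewrite (dvdn_gt0 n0 jn) ltnS dvdn_leq.
  rewrite big_filter_cond /= big_nat_cond [RHS]big_nat_cond.
  apply: eq_bigr => j /andP[/andP[j0 jn] /andP[dj oj]].
  have jn0 : (0 < n %/ j)%N by rewrite divn_gt0.
  rewrite Ac ?jn0 ?leq_div // mulr_sumr.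
  (* The range of [d] is made independent of [j]; the added [d] exceed n/j and cannot divide it. *)
  rewrite [RHS](big_cat_nat (n := (n %/ j).+1)) //=; last by rewrite ltnS leq_div.
  rewrite [X in _ + X]big_nat_cond [X in _ + X]big_pred0 ?addr0 // => d.
  apply/negP => /andP[/andP[ld _] /andP[dd _]].
  by rewrite leqNgt ltnS dvdn_leq in ld.
rewrite (exchange_big_dep (fun d => (d %| n) && odd (n %/ d))%N) /=; last first.
  move=> j d /andP[jn oj] /andP[dnj od].
  have j0 := dvdn_gt0 n0 jn.
  have nj0 : (0 < n %/ j)%N by rewrite divn_gt0 // dvdn_leq.
  have d0 := dvdn_gt0 nj0 dnj.
  pose q := (n %/ j %/ d)%N; rewrite -/q in od.
  have E : n = (q * j * d)%N by rewrite /q mulnAC !divnK.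
  by rewrite E dvdn_mull // mulnK // oddM od.
transitivity (\sum_(1 <= d < n.+1 | ((d %| n) && odd (n %/ d))%N)
    if d == n then c d else 0).
  rewrite big_nat_cond [RHS]big_nat_cond.
  apply: eq_bigr => d /andP[/andP[d0 ltdn] /andP[dn od]].
  have e0 : (0 < n %/ d)%N by rewrite divn_gt0.
  rewrite (eq_bigl (fun j => (j %| n %/ d)%N)) => [|j]; last first.
    apply/idP/idP => [/andP[/andP[jn _] /andP[dnj _]]|je].
      rewrite -(divnK jn) -{1}(divnK dnj) mulnAC mulnK //.
      exact: dvdn_mull.
    have j0 := dvdn_gt0 e0 je.
    pose q := (n %/ d %/ j)%N.
    have ndE : (n %/ d = q * j)%N by rewrite divnK.
    have nE : n = (q * d * j)%N by rewrite mulnAC -ndE divnK.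
    move: od; rewrite ndE oddM => /andP[oq ->].
    by rewrite nE dvdn_mull // mulnK // dvdn_mull // mulnK.
  rewrite -mulr_suml -rmorph_sum /=.
  have -> : \sum_(1 <= j < n.+1 | (j %| n %/ d)%N) moebius j = (n %/ d == 1)%N%:R.
    rewrite -(@sum_moebius _ n.+1) ?e0 ?ltnS ?leq_div // big_geq_mkord.
    by apply: eq_bigl => j; case: (boolP (_ %| _)%N) => //= /(dvdn_gt0 e0).
  have -> : (n %/ d == 1)%N = (d == n).
    by apply/eqP/eqP => [n1|->]; rewrite ?divnn ?n0 // -(divnK dn) n1 mul1n.
  by case: eqP; rewrite ?mul1r ?mul0r.
rewrite -big_mkcondr big_nat1_cond_eq n0 ltnSn dvdnn divnn n0 //.
Qed.

(** * From tuples of coefficients to polynomials *)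

Section CountS2.
Context {R : comNzRingType} (M : nat).

Lemma coef_monic_of m (t : m.-tuple 'F_2) i :
  (monic_of t)`_i = if (i < m)%N then t`_i else (i == m)%:R.
Proof.
rewrite coefD coefXn coef_poly; case: ltnP => [im|mi]; last by rewrite addr0.
by rewrite ltn_eqF ?add0r.
Qed.

Lemma size_monic_of m (t : m.-tuple 'F_2) : size (monic_of t) = m.+1.
Proof.
by rewrite size_polyDl size_polyXn // ltnS size_poly.
Qed.

(** Self-reciprocity moves the prescribed coefficient from index 2d - 1 to index 1, where [slope]
    reads it. *)
Lemma S2E d a : (0 < d)%N -> (d.*2 < M)%N ->
  (S2 d a)%:R = \sum_(P : {poly_M 'F_2} | [&& irreducibleb P,
    reciprocal P == P :> {poly _}, size P == d.*2.+1 & P`_1 == a]) 1 :> R.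
Proof.
move=> d0 dM; rewrite /S2 -sum1_card natr_sum.
rewrite [RHS](reindex_onto
  (fun t : (2 * d).-tuple 'F_2 => npolyp M (monic_of t))
  (fun P : {poly_M 'F_2} => [tuple P`_i | i < 2 * d])) /=; last first.
  move=> P /and4P[_ _ /eqP sP _]; apply: val_inj => /=.
  have mE : monic_of [tuple P`_i | i < 2 * d] = P.
    apply/polyP => i; rewrite coef_monic_of.
    case: ltnP => [id|di].
      by rewrite -[i]/(val (Ordinal id)) -tnth_nth tnth_mktuple.
    move: di; rewrite leq_eqVlt => /orP[/eqP <-|id].
      by rewrite eqxx mul2n (lead_coef_size sP).
    by rewrite gtn_eqF // nth_default // sP -mul2n.
  by rewrite [npolyp _ _ : {poly _}]npolypK mE // sP.
apply: eq_bigl => t.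
have sm : size (monic_of t) = d.*2.+1 by rewrite size_monic_of mul2n.
have smM : (size (monic_of t) <= M)%N by rewrite sm.
have -> : [tuple (npolyp M (monic_of t))`_i | i < 2 * d] = t.
  apply: eq_from_tnth => i; rewrite tnth_mktuple npolypK //.
  by rewrite coef_monic_of ltn_ord -tnth_nth.
rewrite inE npolypK // sm eqxx [t == t]eqxx andbT /=.
have pal : reciprocal (monic_of t) == monic_of t ->
    (monic_of t)`_(2 * d).-1 = (monic_of t)`_1.
  move=> /(self_reciprocalP sm) ->; last by rewrite mul2n leq_pred.
  by congr (_`_ _); lia.
apply/asboolP/and3P => [[iP [rP aP]]|[/irreducibleP iP rP /eqP aP]].
  have {}rP : reciprocal (monic_of t) == monic_of t by apply/eqP.
  by split=> //; [apply/irreducibleP|rewrite -pal // aP].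
by split=> //; split; [apply/eqP|rewrite pal].
Qed.

End CountS2.

Lemma sr_irreducible_sum_S2 (R : comNzRingType) M (s : R) d :
  (0 < d)%N -> (d.*2 < M)%N ->
  sr_irreducible_sum M s d = (S2 d 0)%:R + s * (S2 d 1)%:R.
Proof.
move=> d0 dM; rewrite !(@S2E _ M) // mulr_sumr /sr_irreducible_sum.
rewrite (bigID (fun P : {poly_M 'F_2} => P`_1 == 0)) /=; congr (_ + _).
  apply: eq_big => [P|P /andP[_ /eqP P1]]; first by rewrite -!andbA.
  by rewrite /slope P1 eqxx.
apply: eq_big => [P|P /andP[_ P1]]; first by rewrite -!andbA F2_neq0.
by rewrite /slope P1 expr1 mulr1.
Qed.

(** * Power sums of the reciprocal roots of 1 + T + 2T^2 *)

Section Trigonometry.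
Context {R : realType}.
Let theta : R := acos (1 / (2 * Num.sqrt 2)).
(** The sum of the m-th powers of -sqrt 2 e^(i theta) and its conjugate, in real form. *)
Let v m : R := (-1) ^+ m * powR 2 (m%:R / 2 + 1) * cos (m%:R * theta).

Lemma cos_theta : cos theta = 1 / (2 * Num.sqrt 2).
Proof.
have r0 : 0 < Num.sqrt 2 :> R by rewrite sqrtr_gt0.
have r1 : 1 <= Num.sqrt 2 :> R.
  by rewrite -[leLHS]sqrtr1 ler_wsqrtr // ler1n.
rewrite acosK // in_itv /=; apply/andP; split.
  by apply: (@le_trans _ _ 0); [lra|apply: divr_ge0 => //; lra].
by rewrite ler_pdivrMr; lra.
Qed.

Lemma powR2_half m : powR 2 (m%:R / 2 + 1) = 2 * Num.sqrt 2 ^+ m :> R.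
Proof.
rewrite powRD; last by apply/implyP; rewrite pnatr_eq0.
rewrite powRr1 // [LHS]mulrC; congr (2 * _).
by rewrite mulrC powRrM powR12_sqrt // powR_mulrn ?sqrtr_ge0.
Qed.

(** The two roots have sum -2 sqrt 2 cos theta = -1 and product 2; in real form this is the addition
    formula for cos((m + 2) theta). *)
Lemma sqrt2_cosine_rec m : v m.+2 = - v m.+1 - 2 * v m.
Proof.
have r2 : Num.sqrt 2 ^+ 2 = 2 :> R by rewrite sqr_sqrtr.
have r0 : 0 < Num.sqrt 2 :> R by rewrite sqrtr_gt0.
have cosE : cos (m.+2%:R * theta) =
    2 * cos theta * cos (m.+1%:R * theta) - cos (m%:R * theta).
  have -> : m.+2%:R * theta = m.+1%:R * theta + theta.
    by rewrite -[m.+2]addn1 natrD mulrDl mul1r.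
  have -> : m%:R * theta = m.+1%:R * theta - theta.
    by rewrite -[m.+1]addn1 natrD mulrDl mul1r addrK.
  by rewrite cosB cosD; ring.
rewrite /v !powR2_half cosE cos_theta !exprS.
set c1 := cos _; set c0 := cos _; set r := Num.sqrt 2 in r2 r0 *.
have rE : r * r = 2 by rewrite -r2 expr2.
set c := 1 / _; have rc : r * c = 1 / 2.
  by rewrite /c; field; rewrite gt_eqF.
set e := (-1) ^+ m; set p := r ^+ m.
(* Grouped so that only r r = 2 and r c = 1/2 have to be substituted. *)
transitivity (e * p * (4 * r * (r * c) * c1 - 2 * (r * r) * c0)); first by ring.
by rewrite rE rc; field.
Qed.

Lemma sqrt2_cosine0 : v 0 = 2.
Proof. by rewrite /v powR2_half !expr0 mul0r cos0 mul1r !mulr1. Qed.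

Lemma sqrt2_cosine1 : v 1 = -1.
Proof.
rewrite /v powR2_half !expr1 mul1r cos_theta.
have r0 : Num.sqrt 2 != 0 :> R by rewrite gt_eqF // sqrtr_gt0.
by field.
Qed.

End Trigonometry.

(** * Values of the irreducible sums and the resulting divisor sums *)

Section IrreducibleSums.
Context {R : numFieldType} (N : nat).
(** Sizes up to [M] are degrees up to 2N, room for the self-reciprocal polynomials of degree 2m with
    m <= N. *)
Let M := N.*2.+1.

Let sqr1 : 1 * 1 = 1 :> R. Proof. exact: mulr1. Qed.
Let sqrN1 : -1 * -1 = 1 :> R. Proof. by rewrite mulrNN mulr1. Qed.

Lemma slope2_irreducible_sum_one m : (0 < m <= N)%N ->
  irreducible_sum M const1 id (slope2 (1 : R)) m = 2 ^+ m - 1.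
Proof.
apply: (power_sum_geometric (S := degree_sum M const1 (slope2 1))).
- by move=> n nN; apply: slope2_log_derivative => //; rewrite /M; lia.
- by rewrite slope2_sum0.
- by move=> n nN; rewrite slope2_sum_one // /M; lia.
Qed.

(** Odd degrees contribute nothing, so the series lives in T^2; passing to half degrees divides the
    logarithmic derivative by 2. *)
Lemma slope_half_log_derivative (s : R) : s * s = 1 -> forall n, (n <= N)%N ->
  degree_sum M sr_root1_free (slope s) n.*2 *+ n = \sum_(1 <= m < n.+1)
    degree_sum M sr_root1_free (slope s) (n - m).*2 *
    (irreducible_sum M root1_free sr_hull (slope s) m.*2 / 2).
Proof.
move=> s2 n nN; apply: (@mulIf _ 2); first by rewrite pnatr_eq0.
rewrite mulr_natr -mulrnA muln2 slope_log_derivative //; last by rewrite /M; lia.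
rewrite big_nat_double => [|m om mn]; last first.
  by rewrite slope_sum_odd ?mul0r // oddB ?(ltnW mn) // odd_double om.
rewrite mulr_suml; apply: eq_bigr => m _.
by rewrite doubleB -mulrA divfK // pnatr_eq0.
Qed.

Lemma slope_irreducible_sum_one m : (0 < m <= N)%N ->
  irreducible_sum M root1_free sr_hull (slope (1 : R)) m.*2 = 2 * (2 ^+ m - 1).
Proof.
move=> mN; have n2 : 2 != 0 :> R by rewrite pnatr_eq0.
rewrite [RHS]mulrC -[LHS](divfK n2); congr (_ * 2).
apply: (power_sum_geometric (slope_half_log_derivative sqr1) _ _ mN).
- by rewrite slope_sum0.
- by move=> n nN; rewrite slope_sum_one // /M; lia.
Qed.

Lemma slope_irreducible_sum_minus_one m : (0 < m <= N)%N ->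
  irreducible_sum M root1_free sr_hull (slope (- 1 : R)) m.*2 = - 2.
Proof.
move=> mN; have n2 : 2 != 0 :> R by rewrite pnatr_eq0.
rewrite -[RHS]mulN1r -[LHS](divfK n2); congr (_ * 2).
apply: (power_sum_linear (slope_half_log_derivative sqrN1) _ _ _ mN).
- by rewrite slope_sum0.
- by rewrite slope_sum2 // /M; move: mN; lia.
- by move=> n nN; rewrite slope_sum_minus_one // /M; lia.
Qed.

(** The identity for [sr_irreducible_sum] has the value 2^m at s = 1 and -1 - K at s = -1; their
    difference and sum isolate the two counts, each with the factor 2 * 2d = 4d. *)
Lemma S2_divisor_sums m : (0 < m <= N)%N ->
  let K : R := irreducible_sum M const1 id (slope2 (-1)) m in
  2 ^+ m + 1 + K = \sum_(1 <= d < m.+1 | ((d %| m) && odd (m %/ d))%N)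
      (S2 d 1)%:R * (4 * d%:R) /\
  2 ^+ m - 1 - K = \sum_(1 <= d < m.+1 | ((d %| m) && odd (m %/ d))%N)
      (S2 d 0)%:R * (4 * d%:R).
Proof.
move=> /andP[m0 mN] K.
have mM : (m.*2 < M)%N by rewrite /M; lia.
have mN' : (0 < m <= N)%N by rewrite m0.
have sumE (s : R) : s * s = 1 -> \sum_(1 <= d < m.+1 | ((d %| m) && odd (m %/ d))%N)
    ((S2 d 0)%:R + s * (S2 d 1)%:R) *+ d.*2 =
    irreducible_sum M root1_free sr_hull (slope s) m.*2
    - irreducible_sum M const1 id (slope2 s) m + 1.
  move=> s2; rewrite -sr_irreducible_sumE //.
  rewrite big_nat_cond [RHS]big_nat_cond.
  apply: eq_bigr => d /andP[/andP[d0 dm] _].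
  by rewrite sr_irreducible_sum_S2 // /M; lia.
have := sumE _ sqr1; have := sumE _ sqrN1.
rewrite slope_irreducible_sum_one // slope_irreducible_sum_minus_one //.
rewrite slope2_irreducible_sum_one // -/K => EN E1; split.
  transitivity ((2 * (2 ^+ m - 1) - (2 ^+ m - 1) + 1) - (- 2 - K + 1)).
    by ring.
  rewrite -EN -E1 -sumrB; apply: eq_bigr => d _.
  by rewrite -mulrnBl -[LHS]mulr_natr -muln2 natrM; ring.
transitivity ((2 * (2 ^+ m - 1) - (2 ^+ m - 1) + 1) + (- 2 - K + 1)).
  by ring.
rewrite -EN -E1 -big_split; apply: eq_bigr => d _ /=.
by rewrite -mulrnDl -[LHS]mulr_natr -muln2 natrM; ring.
Qed.

End IrreducibleSums.

(** Both sides obey the recurrence of 1 + T + 2T^2 and start with 1 and 3. *)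
Lemma slope2_irreducible_sum_cos (R : realType) N m : (0 < m <= N)%N ->
  irreducible_sum N.*2.+1 const1 id (slope2 (- 1 : R)) m =
  - ((-1) ^+ m * powR 2 (m%:R / 2 + 1)
     * cos (m%:R * acos (1 / (2 * Num.sqrt 2)))).
Proof.
case/andP=> m0 mN; pose M := N.*2.+1.
pose K := irreducible_sum M const1 id (slope2 (- 1 : R)).
rewrite -/M -/(K m); have N0 := leq_trans m0 mN.
have sqrN1 : -1 * -1 = 1 :> R by rewrite mulrNN mulr1.
have [] := @power_sum_quadratic R N (degree_sum M const1 (slope2 (-1))) K.
- by move=> n nN; apply: slope2_log_derivative => //; rewrite /M; lia.
- by rewrite slope2_sum0.
- by rewrite slope2_sum1 // /M; lia.
- by rewrite slope2_sum2 // /M; lia.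
- by move=> n nN; rewrite slope2_sum_minus_one // /M; lia.
move=> K1 K2 KS; set theta := acos _.
pose v n : R := (-1) ^+ n * powR 2 (n%:R / 2 + 1) * cos (n%:R * theta).
have v0 : v 0%N = 2 := sqrt2_cosine0.
have v1 : v 1%N = -1 := sqrt2_cosine1.
have vS n : v n.+2 = - v n.+1 - 2 * v n := sqrt2_cosine_rec n.
(* Two consecutive values are carried along, each guarded by the range in which [K] is
   controlled. *)
suff Kv n : ((n < N)%N -> K n.+1 = - v n.+1) /\
            ((n.+1 < N)%N -> K n.+2 = - v n.+2).
  by case: m m0 mN => // m _ mN; apply: (Kv m).1.
elim: n => [|n [IH1 IH2]]; split=> // nN.
- by rewrite K1 // v1 opprK.
- by rewrite K2 // vS v0 v1; ring.
by rewrite KS // IH1 ?IH2 ?(ltnW (ltnW nN)) ?(ltnW nN) // [in RHS]vS; ring.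
Qed.

Unset Implicit Arguments.

Theorem theorem4 (R : realType) (n : nat) (hn : (1 <= n)%N) :
  let theta : R := acos (1 / (2 * Num.sqrt 2)) in
  ((S2 n 1)%:R : R) =
    (4 * n%:R)^-1 * \sum_(j <- divisors n | odd j)
      (moebius j)%:~R * (2 ^+ (n %/ j) + 1
        - (-1) ^+ (n %/ j) * powR 2 ((n %/ j)%:R / (2 : R) + 1)
          * cos ((n %/ j)%:R * theta))
  /\
  ((S2 n 0)%:R : R) =
    (4 * n%:R)^-1 * \sum_(j <- divisors n | odd j)
      (moebius j)%:~R * (2 ^+ (n %/ j) - 1
        + (-1) ^+ (n %/ j) * powR 2 ((n %/ j)%:R / (2 : R) + 1)
          * cos ((n %/ j)%:R * theta)).
Proof.
move=> theta.
pose v m : R := (-1) ^+ m * powR 2 (m%:R / 2 + 1) * cos (m%:R * theta).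
have n4 : 4 * n%:R != 0 :> R by rewrite mulf_neq0 ?pnatr_eq0 // -lt0n.
(* Inversion isolates [S2 n a] times 4n, the factor that the prefactor cancels. *)
have inv a (A : nat -> R) : (forall m, (0 < m <= n)%N -> A m =
    \sum_(1 <= d < m.+1 | ((d %| m) && odd (m %/ d))%N)
      (S2 d a)%:R * (4 * d%:R)) ->
    (S2 n a)%:R = (4 * n%:R)^-1 *
      \sum_(j <- divisors n | odd j) (moebius j)%:~R * A (n %/ j)%N.
  by move=> AE; rewrite (moebius_inversion_odd hn AE) mulrC mulfK.
split.
- apply: (inv 1 (fun m => 2 ^+ m + 1 - v m)) => m mn.
  by have [<- _] := @S2_divisor_sums R n m mn; rewrite slope2_irreducible_sum_cos.
- apply: (inv 0 (fun m => 2 ^+ m - 1 + v m)) => m mn.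
  have [_ <-] := @S2_divisor_sums R n m mn.
  by rewrite slope2_irreducible_sum_cos // opprK.
Qed.
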